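(* For $\lambda\in\mathbb{C}$ let $K_\lambda$ denote the filled Julia set of the quadratic polynomial $Q_\lambda(z)=\lambda z+z^2$. Then $$\limsup_{\lambda\to 1,\ |\lambda|=1}\operatorname{Area}(K_\lambda)<\operatorname{Area}(K_1).$$
   Context: $\operatorname{Area}$ is two-dimensional Lebesgue measure on $\mathbb{C}$. The filled Julia set $K_\lambda$ is the set of $z\in\mathbb{C}$ whose forward orbit under $Q_\lambda$ is bounded. The limsup is taken over $\lambda\neq 1$ on the unit circle tending to $1$. *)

(* Defs.v *)
From mathcomp Require Import all_boot all_order all_algebra.
From mathcomp Require Import complex.
From mathcomp Require Import all_classical all_reals all_analysis.

Set Implicit Arguments.
Unset Strict Implicit.
Unset Printing Implicit Defensive.

Import Order.TTheory GRing.Theory Num.Theory.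
Import numFieldNormedType.Exports.

Local Open Scope classical_set_scope.
Local Open Scope ring_scope.
Local Open Scope complex_scope.

Definition quad (R : realType) (lambda z : R[i]) : R[i] := lambda * z + z ^+ 2.

(* The topology and the norm of the complex plane are those of the regular
   module R[i]^o over the numFieldType R[i]; the norm takes real values in
   R[i], so a bound in [bounded_set] is a complex number that is real. *)
Definition filled_julia (R : realType) (lambda : R[i]) : set R[i] :=
  [set z | bounded_set (range (fun n : nat => iter n (quad lambda) z : R[i]^o))].

(* R[i] carries no measure in the library: Lebesgue measure on the complex
   plane is the product measure on R * R, under x +i* y <-> (x, y). *)
Definition area (R : realType) (A : set R[i]) : \bar R :=
  (@lebesgue_measure R \x @lebesgue_measure R)%E
    [set p : R * R | A (p.1 +i* p.2)].

Definition unit_circle (R : realType) : set R[i]^o := [set z | `|z| = 1].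

(* Main.v *)
Require Import Defs.
From mathcomp Require Import all_boot all_order all_algebra.
From mathcomp Require Import complex.
From mathcomp Require Import all_classical all_reals all_analysis.
From mathcomp Require Import measurable_realfun.
From mathcomp Require Import ring lra.

(** The loss of area is parabolic implosion, made explicit by one backward
    orbit.

    The area is upper semicontinuous at 1: the sets [stays n] of points whose
    first n iterates under z + z^2 have modulus at most 4 decrease to the filled
    Julia set of z + z^2, and [shadow] shows that each of them contains the
    filled Julia sets of all parameters of modulus 1 close enough to 1.
    It remains to find a disc, of a radius that does not depend on lambda, which
    lies in the filled Julia set at 1 and misses the one at lambda
    ([lost_ball]).

    In the coordinate x = z - (1 - lambda)/2, centred at the midpoint of the two
    fixed points, the map is x |-> x + v(x) with v(x) = x^2 + eps and
    eps = - (1 - lambda)^2 / 4.  For lambda <> 1 of modulus 1 and close to 1,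
    eps = b^2 + i h with b > 0 small and h = O(b^3) ([gate_parameter]), so the two fixed points, near i b and
    - i b, leave a gate between them through which orbits move from left to
    right along the real axis.  Fix a small r > 0.  Under z + z^2 the point r
    escapes, hence so does a fixed disc around r for every lambda close to 1.
    Follow r backward: the orbit crosses the gate and comes out near - r,
    inside the disc |z + 1/2| <= 1/2, which z + z^2 maps into itself.
    A disc around the point so reached lands near r after finitely many
    steps, so it escapes; three estimates show that neither the position of the
    point nor the radius of the disc degenerates as b tends to 0, although the
    number of steps is of order 1/b.

    - Writing x = X + i Y and V = X^2 + b^2, the real part moves by about V in
      one step, so the sum of V over the orbit is O(r).

    - The ratio |Y| / V is nearly invariant: one backward step increases it by
      at most O(V) + O(b) ([backward_step]).  The first error is paid by the
      displacement of X, the second by the clock [psi], a bounded function of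
      X which advances by at least b/5 in each step ([psi_increase]).  So
      |Y| <= 240 V all along, which is O(r^2) at the exit.

    - The identity v(x + v(x)) = v(x) (1 + 2 x + v(x)) says that v evolves
      almost like a tangent vector.  A difference y - x is multiplied by
      1 + 2 x + (y - x), so the quotient (y - x) / v(x) changes in one step by a
      factor 1 + O(|v(x)|), and the sum of |v| over the orbit, which is its
      length, is O(r) ([ball_preimage]).

    [gate] collects the outcome, and [area_drop] turns the disc into a
    definite amount of area. *)

Import Order.TTheory GRing.Theory Num.Theory.
Import numFieldNormedType.Exports.

Set Implicit Arguments.
Unset Strict Implicit.
Unset Printing Implicit Defensive.

Local Open Scope classical_set_scope.
Local Open Scope ring_scope.
Local Open Scope complex_scope.

Import ComplexField.Normc.

Local Notation Re := complex.Re.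
Local Notation Im := complex.Im.

(** * Moduli and bounded orbits *)

Section Modulus.
Variable R : realType.
Implicit Types (z w : R[i]).

Lemma normC_normc z : `|z| = (normc z)%:C.
Proof. by rewrite normc_def; case: z. Qed.

Lemma normc_ge0 z : 0 <= normc z.
Proof. by case: z => a b; rewrite sqrtr_ge0. Qed.

Lemma normc_sqr z : normc z ^+ 2 = Re z ^+ 2 + Im z ^+ 2.
Proof. by case: z => a b; rewrite sqr_sqrtr// addr_ge0 ?sqr_ge0. Qed.

Lemma normcB_le z w : normc z <= normc (z - w) + normc w.
Proof. by rewrite -{1}(subrK w z); exact: le_normcD. Qed.

Lemma normcX z n : normc (z ^+ n) = normc z ^+ n.
Proof. by elim: n => [|n IH]; rewrite ?normc1// !exprS normcM IH. Qed.

Lemma Re_le_normc z : `|Re z| <= normc z.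
Proof.
rewrite -ler_sqr ?nnegrE ?normc_ge0// normc_sqr real_normK ?num_real//.
by rewrite lerDl sqr_ge0.
Qed.

Lemma Im_le_normc z : `|Im z| <= normc z.
Proof.
rewrite -ler_sqr ?nnegrE ?normc_ge0// normc_sqr real_normK ?num_real//.
by rewrite lerDr sqr_ge0.
Qed.

Lemma normc_le_ReIm z : normc z <= `|Re z| + `|Im z|.
Proof.
rewrite -ler_sqr ?nnegrE ?normc_ge0 ?addr_ge0// normc_sqr.
rewrite sqrrD !real_normK ?num_real// -addrA lerD2l lerDr mulrn_wge0// mulr_ge0.
Qed.

Lemma normc_le_sqr z (B : R) : 0 <= B ->
  (normc z <= B) = (Re z ^+ 2 + Im z ^+ 2 <= B ^+ 2).
Proof. by move=> B0; rewrite -normc_sqr ler_sqr ?nnegrE ?normc_ge0. Qed.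

Lemma ReD z w : Re (z + w) = Re z + Re w.
Proof. by case: z w => [a b] [c d]. Qed.

Lemma ImD z w : Im (z + w) = Im z + Im w.
Proof. by case: z w => [a b] [c d]. Qed.

Lemma ReN z : Re (- z) = - Re z.
Proof. by case: z. Qed.

Lemma Re_sqr z : Re (z ^+ 2) = Re z ^+ 2 - Im z ^+ 2.
Proof. by case: z => a b; rewrite expr2 /= !expr2. Qed.

Lemma Im_sqr z : Im (z ^+ 2) = 2 * Re z * Im z.
Proof. by case: z => a b; rewrite expr2 /=; ring. Qed.

End Modulus.

Section Bounded.
Variable R : realType.
Implicit Types (z w lambda : R[i]).

Lemma filled_juliaP lambda z : filled_julia lambda z <->
  exists B : R, forall n, normc (iter n (quad lambda) z) <= B.
Proof.
rewrite /filled_julia /= /bounded_set /bounded_near; split.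
- case=> M [/= Mreal] /(_ (M + 1)).
  rewrite ltrDl ltr01 => /(_ isT) H.
  have [|] := boolP (M + 1 \is Num.real); last by rewrite realD// real1.
  move=> M1; exists (Re (M + 1)) => n.
  have := H (iter n (quad lambda) z) (ex_intro2 _ _ n I erefl).
  by rewrite /= (normC_normc (iter n (quad lambda) z)) -(RRe_real M1) lecR.
- case=> B H; exists B%:C; split.
    by rewrite realE -[0]/(0%:C) !lecR -realE num_real.
  move=> M BM _ [n _ <-]; rewrite /= (normC_normc (iter n (quad lambda) z)).
  by rewrite (le_trans _ (ltW BM))// lecR H.
Qed.

Lemma filled_julia_quad lambda z :
  filled_julia lambda z -> filled_julia lambda (quad lambda z).
Proof.
by move=> /filled_juliaP[B H]; apply/filled_juliaP; exists B => n; rewrite -iterSr.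
Qed.

(** Outside the disc of radius 3, each step adds at least 1 to the modulus. *)
Lemma filled_julia_le3 lambda z : normc lambda = 1 -> filled_julia lambda z ->
  normc z <= 3.
Proof.
move=> l1 /filled_juliaP[B HB]; rewrite leNgt; apply/negP => z3.
have grow n : normc z + n%:R <= normc (iter n (quad lambda) z).
  elim: n => [|n IH] /=; first by rewrite addr0.
  move: IH; set y := iter n _ z => IH.
  have : normc (y ^+ 2) <= normc (quad lambda y) + normc (lambda * y).
    by rewrite -(normcN (lambda * y)) -{1}(addKr (lambda * y) (y ^+ 2)) addrC le_normcD.
  rewrite normcX normcM l1 mul1r -natr1.
  have n0 : 0 <= n%:R :> R by rewrite ler0n.
  by move=> H; nra.
have := HB (Num.truncn B).+1; have := grow (Num.truncn B).+1.
have := truncnS_gt B; have := normc_ge0 z; lra.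
Qed.

End Bounded.

(** * One backward step near the gate *)

Section RealStep.
Variable R : realType.
Implicit Types b h t X Y G w : R.

Lemma mulrB_ge0 (x y z : R) : 0 <= x -> y <= z -> 0 <= x * (z - y).
Proof. by move=> x0 yz; rewrite mulr_ge0// subr_ge0. Qed.

(** The estimates for one backward step (X, Y) <- (X', Y') of
    x |-> x + x^2 + b^2 + i h.  The vertical equation gives
    |Y| <= (|Y'| + |h|) / (1 + 2 X).  Since V' = X'^2 + b^2 equals
    V (1 + 2 X) up to O(V^2), dividing by V turns a bound |Y'| <= G V' into
    |Y| <= (G + O(V) + O(b)) V, the last term coming from
    |h| <= 6 b^3 <= 6 b V. *)
Lemma backward_step b h t X Y X' Y' G :
  10 ^+ 9 * t <= 1 -> 0 < b -> b <= t -> `|h| <= 6 * b ^+ 3 ->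
  `|X| <= t -> `|Y| <= t ->
  X' = X + X ^+ 2 - Y ^+ 2 + b ^+ 2 -> Y' = Y * (1 + 2 * X) + h ->
  G <= 240 -> `|Y'| <= G * (X' ^+ 2 + b ^+ 2) ->
  let V := X ^+ 2 + b ^+ 2 in
  [/\ 9 / 10 * V <= X' - X <= V, `|Y| <= 3 * 10 ^+ 3 * V
    & `|Y| <= V * (G + 960 * V + 12 * b)].
Proof.
move=> t_small b_gt0 b_le h_le X_le Y_le X'E Y'E G_le Y'_le; cbv zeta.
have [V VE] : exists V, V = X ^+ 2 + b ^+ 2 by eexists.
have [V' V'E] : exists V', V' = X' ^+ 2 + b ^+ 2 by eexists.
have [y yE] : exists y, y = `|Y| by eexists.
rewrite -VE -yE; rewrite -V'E in Y'_le; rewrite -yE in Y_le.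
have t_gt0 : 0 < t by exact: lt_le_trans b_gt0 b_le.
have V_gt0 : 0 < V by rewrite VE ltr_wpDl ?sqr_ge0// exprn_gt0.
have V'_gt0 : 0 < V' by rewrite V'E ltr_wpDl ?sqr_ge0// exprn_gt0.
have X_bnd : - t <= X <= t by rewrite -ler_norml.
have tt_le : 10 ^+ 9 * t ^+ 2 <= t.
  by have := mulrB_ge0 (ltW t_gt0) t_small; clear; lra.
have V_le : V <= 2 * t ^+ 2.
  have : X ^+ 2 <= t ^+ 2.
    by rewrite -(real_normK (num_real X)) ler_sqr ?nnegrE// ltW.
  have : b ^+ 2 <= t ^+ 2 by rewrite ler_sqr ?nnegrE// ltW.
  by rewrite VE; clear; lra.
have Vt : 10 ^+ 8 * V <= t by clear - V_le tt_le t_gt0; lra.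
have b3_le : b ^+ 3 <= b * V.
  by rewrite exprS ler_pM2l// VE lerDr sqr_ge0.
have bV0 : 0 <= b * V by rewrite mulr_ge0// ltW.
have Y2 : Y ^+ 2 = y ^+ 2 by rewrite yE real_normK ?num_real.
have y0 : 0 <= y by rewrite yE.
have q : 9 / 10 <= 1 + 2 * X by clear - X_bnd t_small; lra.
have p : 0 < 1 + 2 * X by clear - q; lra.
have YE : (1 + 2 * X) * y = `|Y' - h|.
  by rewrite yE Y'E addrK normrM (gtr0_norm p) mulrC.
have Yh : (1 + 2 * X) * y <= G * V' + 6 * (b * V).
  rewrite YE (le_trans (ler_normB _ _))// lerD// (le_trans h_le)//.
  by rewrite ler_pM2l.
have Yge0 := sqr_ge0 Y.
(* A first bound on Y, with a worse constant but in terms of V alone. *)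
have rough : y <= 3 * 10 ^+ 3 * V.
  have V1 : V <= 1 / 3 by clear - Vt t_small; lra.
  have V2 := mulrB_ge0 (ltW V_gt0) V1.
  have V'_le : V' <= 4 * V + 3 * (Y ^+ 2) ^+ 2.
    have -> : V' = (X + V - Y ^+ 2) ^+ 2 + b ^+ 2.
      by rewrite V'E X'E VE; ring.
    have := sqr_ge0 (X - V); have := sqr_ge0 (X + Y ^+ 2).
    have := sqr_ge0 (V + Y ^+ 2); have := sqr_ge0 b.
    by clear - V2 VE; lra.
  have y1 : y <= 1 / 10 ^+ 4 by clear - Y_le t_small; lra.
  have y2 := mulrB_ge0 y0 y1.
  have Y21 : y ^+ 2 <= 1 by clear - y1 y2; lra.
  have Y4 : (Y ^+ 2) ^+ 2 <= 1 / 10 ^+ 4 * y.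
    rewrite Y2.
    have := mulrB_ge0 (sqr_ge0 y) Y21.
    by clear - y2; lra.
  have b1 : b <= 1 / 10 ^+ 4 by clear - b_le t_small; lra.
  have bV := mulrB_ge0 (ltW V_gt0) b1.
  have GV := mulrB_ge0 (ltW V'_gt0) G_le.
  have := mulrB_ge0 y0 q.
  by clear - bV GV Yh Y4 V'_le y0 V_gt0; lra.
have t1 : t <= 1 / 10 ^+ 9 by clear - t_small; lra.
have Ysq : Y ^+ 2 <= 1 / 10 ^+ 5 * V.
  have := ler_pM y0 y0 rough Y_le; rewrite -expr2 -Y2.
  have := mulrB_ge0 (ltW V_gt0) t1.
  by clear - V_gt0; lra.
have Y22 : Y ^+ 2 <= (3 * 10 ^+ 3 * V) ^+ 2.
  by have := ler_pM y0 y0 rough rough; rewrite -!expr2 -Y2.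
split=> //.
  have -> : X' - X = V - Y ^+ 2 by rewrite X'E VE; ring.
  by clear - Ysq V_gt0 Yge0; lra.
have XY : - (2 * X * Y ^+ 2) <= V ^+ 2.
  have X1 : - X <= t by clear - X_bnd; lra.
  have := mulrB_ge0 Yge0 X1.
  have := mulrB_ge0 (ltW t_gt0) Y22.
  have := mulrB_ge0 (sqr_ge0 V) t1.
  by have := sqr_ge0 V; clear; lra.
have V'_le : V' <= (1 + 2 * X) * (V + 4 * V ^+ 2).
  have -> : V' = V * (1 + 2 * X) - 2 * X * Y ^+ 2 + (V - Y ^+ 2) ^+ 2.
    by rewrite V'E X'E VE; ring.
  have Y2V : Y ^+ 2 <= 2 * V by clear - Ysq V_gt0; lra.
  have := mulrB_ge0 Yge0 Y2V.
  have := mulrB_ge0 (sqr_ge0 V) q.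
  by have := sqr_ge0 V; clear - XY; lra.
have G_ge0 : 0 <= G.
  by rewrite -(pmulr_lge0 _ V'_gt0) (le_trans _ Y'_le).
have GV' : G * V' <= (1 + 2 * X) * (G * (V + 4 * V ^+ 2)).
  by rewrite mulrCA ler_wpM2l.
have : y <= G * (V + 4 * V ^+ 2) + 12 * (b * V).
  rewrite -(ler_pM2l p) mulrDr (le_trans Yh)// lerD//.
  by have := mulrB_ge0 bV0 q; clear - bV0; lra.
have := mulrB_ge0 (sqr_ge0 V) G_le.
by clear; lra.
Qed.

(** A rational substitute for arctan (X / b): its derivative b / (b + |X|)^2 is
    comparable to b / (X^2 + b^2), so it runs at a rate comparable to b along
    the flow dX/dt = X^2 + b^2, while staying bounded. *)
Definition psi b X := X / (b + `|X|).

Lemma psi_bound b X : 0 < b -> `|psi b X| <= 1.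
Proof.
move=> b0; have d : 0 < b + `|X| by rewrite ltr_wpDr.
rewrite /psi normrM normfV (gtr0_norm d) ler_pdivrMr// mul1r.
by rewrite lerDr ltW.
Qed.

Lemma psi_increase b t X X' : 10 ^+ 9 * t <= 1 -> 0 < b -> b <= t -> `|X| <= t ->
  9 / 10 * (X ^+ 2 + b ^+ 2) <= X' - X <= X ^+ 2 + b ^+ 2 ->
  b / 5 <= psi b X' - psi b X.
Proof.
move=> ts b0 bt Xt /andP[lo hi].
have [V VE] : exists V, V = X ^+ 2 + b ^+ 2 by eexists.
rewrite -VE in lo hi.
have V0 : 0 < V by rewrite VE ltr_wpDl ?sqr_ge0// exprn_gt0.
have d : 0 < b + `|X| by rewrite ltr_wpDr.
have d' : 0 < b + `|X'| by rewrite ltr_wpDr.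
have X2 : X ^+ 2 = `|X| ^+ 2 by rewrite real_normK ?num_real.
have nX : 0 <= `|X| by [].
have h1 : `|X'| <= `|X| + V.
  have -> : X' = X + (X' - X) by ring.
  rewrite (le_trans (ler_normD _ _))// lerD2l ger0_norm//; lra.
have Vd : V <= t * (b + `|X|).
  rewrite VE X2.
  have := mulrB_ge0 nX Xt.
  have := mulrB_ge0 (ltW b0) bt.
  lra.
have prod_le : (b + `|X|) * (b + `|X'|) <= 11 / 5 * V.
  have : (b + `|X|) * (b + `|X'|) <= (b + `|X|) * ((1 + t) * (b + `|X|)).
    by rewrite ler_pM2l//; lra.
  have : (b + `|X|) ^+ 2 <= 2 * V.
    by rewrite VE X2; have := sqr_ge0 (b - `|X|); lra.
  have := @mulrB_ge0 _ t (1 / 10) (sqr_ge0 (b + `|X|)).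
  by move=> /(_ ltac:(lra)); lra.
have -> : psi b X' - psi b X =
    (b * (X' - X) + (X' * `|X| - X * `|X'|)) / ((b + `|X|) * (b + `|X'|)).
  by rewrite /psi; field; rewrite !gt_eqF.
have num : b * (X' - X) <= b * (X' - X) + (X' * `|X| - X * `|X'|).
  rewrite lerDl.
  have XX' : X <= X' by lra.
  case: (ger0P X) => X0; case: (ger0P X') => X'0; try lra; try nra.
rewrite ler_pdivlMr ?mulr_gt0//.
have := ler_pM2l b0 (9 / 10 * V) (X' - X); rewrite lo.
have : b / 5 * ((b + `|X|) * (b + `|X'|)) <= b / 5 * (11 / 5 * V).
  by rewrite ler_wpM2l// divr_ge0// ltW.
have : 0 <= b * V by rewrite mulr_ge0// ltW.
lra.
Qed.

(** The bound on |Y| / V for a backward orbit started at the real point w: the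
    first term pays for the O(V) errors of [backward_step], the second for the
    O(b) errors. *)
Definition drift b w X := 2 * 10 ^+ 3 * (w - X) + 60 * (psi b w - psi b X).

End RealStep.

Section ComplexStep.
Variable R : realType.
Implicit Types (x y : R[i]).

Definition velocity (eps x : R[i]) := x ^+ 2 + eps.

(** Of the two preimages, whose sum is -1, the one with real part at least
    -1/2 is taken.  The product formula x (1 + x) = x' - eps then bounds it,
    since |1 + x| >= 1/2. *)
Lemma small_preimage (eps x' : R[i]) :
  exists2 x, x + velocity eps x = x' & normc x <= 2 * normc (x' - eps).
Proof.
have [s ss Re_s] : exists2 s, s ^+ 2 = 1 / 4 + x' - eps & 0 <= Re s.
  have := sqr_sqrtc (1 / 4 + x' - eps); set s := sqrtc _ => sE.
  case: (leP 0 (Re s)) => s0; first by exists s.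
  by exists (- s); rewrite ?sqrrN// ReN oppr_ge0 ltW.
have xE : s - 1 / 2 + velocity eps (s - 1 / 2) = x'.
  have -> : s - 1 / 2 + velocity eps (s - 1 / 2) = s ^+ 2 + eps - 1 / 4.
    by rewrite /velocity; field.
  by rewrite ss; ring.
exists (s - 1 / 2) => //; move: xE; set x := s - 1 / 2 => xE.
have -> : x' - eps = x * (1 + x) by rewrite -xE /velocity; ring.
rewrite normcM mulrCA ler_peMr ?normc_ge0//.
have half : Re (1 + x) = 1 / 2 + Re s.
  have -> : 1 + x = s + (1 / 2)%:C.
    by rewrite rmorphM rmorph1 fmorphV rmorph_nat /x; field.
  by rewrite ReD /= addrC.
have := Re_le_normc (1 + x); rewrite half.
have := ler_norm (1 / 2 + Re s).
lra.
Qed.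

(** Pulling back a disc of radius proportional to |v|.  With a = 1 + 2 x and
    d = y - x, one step multiplies d by a + d and v by a + v, and these
    factors differ by at most |d| + |v| <= 2 |v|.  As |a + v| >= 1/2, replacing
    c' by c' - 4 |v| absorbs the discrepancy. *)
Lemma ball_preimage (E : set R[i]) eps x kappa c c' :
  (forall y, E (y + velocity eps y) -> E y) ->
  0 <= kappa <= 1 -> c <= 1 ->
  normc x <= 1 / 8 -> normc (velocity eps x) <= 1 / 4 ->
  c + 4 * normc (velocity eps x) <= c' ->
  let x' := x + velocity eps x in
  (forall y, normc (y - x') <= kappa * normc (velocity eps x') * c' -> E y) ->
  forall y, normc (y - x) <= kappa * normc (velocity eps x) * c -> E y.
Proof.
move=> EE /andP[k0 k1] c1 x8 v4 cc' x' Ex' y yx; apply: EE; apply: Ex'.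
pose d := y - x; pose v := velocity eps x; pose a := 1 + 2 * x.
have -> : y + velocity eps y - x' = d * (a + d).
  by rewrite /x' /d /a /velocity; ring.
have -> : velocity eps x' = v * (a + v).
  by rewrite /x' /v /a /velocity; ring.
rewrite !normcM.
have av : 1 / 2 <= normc (a + v).
  have : normc 1%:C <= normc (a + v) + normc (2 * x) + normc v.
    have -> : 1%:C = (a + v) - (2 * x) - v :> R[i] by rewrite rmorph1 /a; ring.
    rewrite (le_trans (le_normcD _ _))// normcN lerD2r.
    by rewrite (le_trans (le_normcD _ _))// normcN.
  rewrite normc1 normcM.
  have -> : normc (2 : R[i]) = 2.
    by rewrite -[2 in LHS](rmorph_nat (real_complex R)) /= expr0n addr0 sqrtr_sqr
      ger0_norm.
  rewrite -/v in v4; clear - v4 x8; lra.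
have ad : normc (a + d) <= normc (a + v) + normc d + normc v.
  have -> : a + d = (a + v) + d - v by ring.
  rewrite (le_trans (le_normcD _ _))// normcN lerD2r.
  exact: le_normcD.
rewrite -/v -/d in yx cc' v4 *.
move: av ad yx cc' v4; have := normc_ge0 v; have := normc_ge0 d.
move: (normc v) (normc d) (normc (a + v)) (normc (a + d)) => nv nd nav nad.
clear - k0 k1 c1 => nd0 nv0 av ad yx cc' v4.
have kv0 : 0 <= kappa * nv by rewrite mulr_ge0.
have kv1 : kappa * nv <= nv by rewrite ler_piMl.
have c0 := mulrB_ge0 kv0 c1.
have ndv : nd <= nv by clear - c0 kv1 yx; lra.
have h1 : nd * nad <= nd * (nav + 2 * nv) by rewrite ler_wpM2l//; clear - ad ndv; lra.
have h2 : nd * (nav + 2 * nv) <= kappa * nv * c * (nav + 2 * nv).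
  by rewrite ler_wpM2r//; clear - av nv0; lra.
have cp : c * (nav + 2 * nv) <= c' * nav.
  have nav0 : 0 <= nav by clear - av; lra.
  have := mulrB_ge0 nav0 cc'.
  have := mulrB_ge0 nv0 c1.
  have := mulrB_ge0 nv0 av.
  by clear; lra.
have := mulrB_ge0 kv0 cp.
by clear - h1 h2; lra.
Qed.

End ComplexStep.

(** * Crossing the gate backward *)

Section Gate.
Variable R : realType.
Implicit Types (r b h kappa : R) (E : set R[i]).

(** By how much the discs have shrunk relative to |v|.  The factor 64 makes
    the loss over one step, 64 times the displacement of the real part, cover
    the 4 |v| needed by [ball_preimage]. *)
Definition shrink r (X : R) := 1 - 64 * (r - X).

(** The invariant of the backward orbit of r.  The set E stands for the points
    that escape. *)
Definition gate_orbit r b h E kappa (x : R[i]) :=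
  let eps := b ^+ 2 +i* h in
  [/\ - (2 * r) <= Re x <= r,
      `|Im x| <= drift b r (Re x) * (Re x ^+ 2 + b ^+ 2) &
      forall y, normc (y - x) <= kappa * normc (velocity eps x) * shrink r (Re x) ->
        E y].

Lemma sqr_small r (X : R) : 0 < r -> 10 ^+ 10 * r <= 1 ->
  `|X| <= 2 * r -> 10 ^+ 9 * X ^+ 2 <= r.
Proof.
move=> r_gt0 r_small Xr; have r2 : 0 <= 2 * r by rewrite mulr_ge0// ltW.
have H : X ^+ 2 <= (2 * r) ^+ 2.
  by rewrite -(real_normK (num_real X)) ler_sqr ?nnegrE.
have := mulrB_ge0 (ltW r_gt0) r_small; clear - H r_gt0; lra.
Qed.

Lemma drift_le r b (X : R) : 0 < r -> 10 ^+ 10 * r <= 1 -> 0 < b ->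
  - (2 * r) <= X -> drift b r X <= 240.
Proof.
move=> r_gt0 r_small b_gt0 Xr; rewrite /drift.
have := psi_bound r b_gt0; have := psi_bound X b_gt0.
rewrite !ler_norml; clear - r_small Xr.
move: (psi b r) (psi b X) => u v /andP[? ?] /andP[? ?]; lra.
Qed.

Lemma b2_small r b : 0 < r -> 10 ^+ 10 * r <= 1 -> 0 < b -> b <= r ->
  10 ^+ 9 * b ^+ 2 <= r.
Proof.
move=> r_gt0 r_small b_gt0 b_le; apply: sqr_small => //.
by rewrite gtr0_norm//; clear - b_le r_gt0; lra.
Qed.

Lemma b3_small r b : 0 < r -> 10 ^+ 10 * r <= 1 -> 0 < b -> b <= r ->
  b ^+ 3 <= 1 / 10 ^+ 4 * b ^+ 2.
Proof.
move=> r_gt0 r_small b_gt0 b_le.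
rewrite exprS ler_wpM2r ?sqr_ge0//; clear - b_le r_small; lra.
Qed.

Lemma gate_orbit_height r b h E kappa x : 0 < r -> 10 ^+ 10 * r <= 1 -> 0 < b -> b <= r ->
  gate_orbit r b h E kappa x -> `|Im x| <= r.
Proof.
move=> r_gt0 r_small b_gt0 b_le [/andP[lo hi] Hh _].
have X2r : `|Re x| <= 2 * r by rewrite ler_norml; clear - lo hi r_gt0; lra.
have X2 := sqr_small r_gt0 r_small X2r.
have V0 : 0 <= Re x ^+ 2 + b ^+ 2 by rewrite addr_ge0 ?sqr_ge0.
have := mulrB_ge0 V0 (drift_le r_gt0 r_small b_gt0 lo);
have := b2_small r_gt0 r_small b_gt0 b_le.
by clear - X2 Hh r_gt0; lra.
Qed.

(** Every coordinate stays below 6 r by [small_preimage], so [backward_step]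
    applies and its two error terms are exactly what [drift] gains. *)
Lemma gate_orbit_step r b h E kappa x' :
  0 < r -> 10 ^+ 10 * r <= 1 -> 0 < b -> b <= r ->
  `|h| <= 6 * b ^+ 3 -> 0 <= kappa <= 1 ->
  (forall y, E (y + velocity (b ^+ 2 +i* h) y) -> E y) ->
  gate_orbit r b h E kappa x' -> - r < Re x' ->
  exists2 x, gate_orbit r b h E kappa x & Re x <= Re x' - b ^+ 2 / 2.
Proof.
move=> r_gt0 r_small b_gt0 b_le h_le kappa01 E_preimage gx' X'r.
pose eps := b ^+ 2 +i* h.
have Y'r := gate_orbit_height r_gt0 r_small b_gt0 b_le gx'.
case: gx' => /andP[lo' hi'] Hh' Hball'.
have [x xE x_le] := small_preimage eps x'.
have b2 := b2_small r_gt0 r_small b_gt0 b_le.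
have b3 := b3_small r_gt0 r_small b_gt0 b_le.
have x'_le : normc x' <= 2 * r.
  have X'n : `|Re x'| <= r by rewrite ler_norml; clear - X'r hi'; lra.
  by rewrite (le_trans (normc_le_ReIm _))//; clear - X'n Y'r; lra.
have eps_le : normc eps <= r.
  rewrite (le_trans (normc_le_ReIm _))//= ger0_norm ?sqr_ge0//.
  by clear - b2 b3 h_le r_gt0; lra.
have xr : normc x <= 6 * r.
  rewrite (le_trans x_le)//.
  have := le_normcD x' (- eps); rewrite normcN; clear - eps_le x'_le; lra.
have X_le := le_trans (Re_le_normc x) xr.
have Y_le := le_trans (Im_le_normc x) xr.
have X'E : Re x' = Re x + Re x ^+ 2 - Im x ^+ 2 + b ^+ 2.
  by rewrite -xE /velocity !ReD Re_sqr /= !addrA.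
have Y'E : Im x' = Im x * (1 + 2 * Re x) + h.
  by rewrite -xE /velocity !ImD Im_sqr /=; ring.
have t_small : 10 ^+ 9 * (6 * r) <= 1 by clear - r_small r_gt0; lra.
have bt : b <= 6 * r by clear - b_le r_gt0; lra.
have [desc rough height] := backward_step t_small b_gt0 bt h_le X_le Y_le X'E Y'E
  (drift_le r_gt0 r_small b_gt0 lo') Hh'.
have psi_inc := psi_increase t_small b_gt0 bt X_le desc.
move: desc rough height; set V := Re x ^+ 2 + b ^+ 2.
move=> /andP[d1 d2] rough height.
have Vb : b ^+ 2 <= V by rewrite /V lerDr sqr_ge0.
have V0 : 0 < V by rewrite (lt_le_trans _ Vb)// exprn_gt0.
have X_lo : - (2 * r) <= Re x.
  (* The real part moves by at most V, which is quadratically small in r. *)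
  have X2 := ler_pM (normr_ge0 _) (normr_ge0 _) X_le X_le.
  rewrite -expr2 real_normK ?num_real// in X2.
  have Vr : V <= r.
    have := mulrB_ge0 (ltW r_gt0) r_small.
    by rewrite /V; clear - X2 b2 r_gt0; lra.
  by clear - Vr d2 X'r; lra.
exists x; last by clear - d1 Vb V0; lra.
split.
- by rewrite X_lo /=; clear - d1 V0 hi'; lra.
- rewrite (le_trans height)// mulrC ler_wpM2r ?(ltW V0)//.
  rewrite /drift; clear - psi_inc d1 V0.
  by move: V V0 d1 (psi b r) (psi b (Re x)) (psi b (Re x')) psi_inc; intros; lra.
have vE : velocity eps x = x' - x by rewrite -xE; ring.
have v_le : normc (velocity eps x) <= 16 * (Re x' - Re x).
  rewrite (le_trans (normc_le_ReIm _))//.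
  have -> : Re (velocity eps x) = Re x' - Re x by rewrite vE ReD ReN.
  have -> : Im (velocity eps x) = 2 * Re x * Im x + h.
    by rewrite /velocity ImD Im_sqr.
  have dpos : 0 <= Re x' - Re x by clear - d1 V0; lra.
  rewrite (ger0_norm dpos).
  have : `|2 * Re x * Im x + h| <= 2 * (6 * r) * (3 * 10 ^+ 3 * V) + 6 * b ^+ 3.
    rewrite (le_trans (ler_normD _ _))// lerD// normrM ler_pM// normrM.
    by rewrite ler_pM// ger0_norm.
  have := @mulrB_ge0 _ V r (1 / 10 ^+ 10) (ltW V0).
  have -> : r <= 1 / 10 ^+ 10 by clear - r_small; lra.
  by move=> /(_ isT); clear - d1 V0 b3 Vb; lra.
have x8 : normc x <= 1 / 8 by clear - xr r_small r_gt0; lra.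
have v4 : normc (velocity eps x) <= 1 / 4.
  by clear - v_le X_lo hi' r_small; lra.
have c1 : shrink r (Re x) <= 1.
  by rewrite /shrink; clear - d1 V0 hi'; lra.
have cc' : shrink r (Re x) + 4 * normc (velocity eps x) <= shrink r (Re x').
  by rewrite /shrink; clear - v_le; lra.
apply: (ball_preimage E_preimage kappa01 c1 x8 v4 cc') => y /=.
by rewrite xE; exact: Hball'.
Qed.

(** Each step moves left by at least b^2 / 2, so the left side is reached. *)
Lemma gate_orbit_iter r b h E kappa n x :
  0 < r -> 10 ^+ 10 * r <= 1 -> 0 < b -> b <= r ->
  `|h| <= 6 * b ^+ 3 -> 0 <= kappa <= 1 ->
  (forall y, E (y + velocity (b ^+ 2 +i* h) y) -> E y) ->
  gate_orbit r b h E kappa x ->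
  (exists2 y, gate_orbit r b h E kappa y & Re y <= - r) \/
  (exists2 y, gate_orbit r b h E kappa y & Re y <= Re x - n%:R * (b ^+ 2 / 2)).
Proof.
move=> r_gt0 r_small b_gt0 b_le h_le kappa01 E_preimage gx.
elim: n => [|n [IH|[y gy yn]]]; first by right; exists x => //; rewrite mul0r subr0.
  by left.
have [yr|yr] := leP (Re y) (- r); first by left; exists y.
right; have [z gz zy] := gate_orbit_step r_gt0 r_small b_gt0 b_le h_le kappa01
  E_preimage gy yr.
exists z => //.
by rewrite -natr1; move: n%:R yn zy; clear; intros; lra.
Qed.

(** The discs of the invariant have radius at least kappa V / 4 at the exit,
    where V >= r^2 whatever b is; this is the uniformity in b. *)
Lemma gate r b h E kappa :
  0 < r -> 10 ^+ 10 * r <= 1 -> 0 < b -> b <= r ->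
  `|h| <= 6 * b ^+ 3 -> 0 <= kappa <= 1 ->
  (forall y, E (y + velocity (b ^+ 2 +i* h) y) -> E y) ->
  (forall y, normc (y - r%:C) <= kappa -> E y) ->
  exists x, [/\ - (2 * r) <= Re x <= - r, `|Im x| <= r / 100 &
    forall y, normc (y - x) <= kappa * r ^+ 2 / 4 -> E y].
Proof.
move=> r_gt0 r_small b_gt0 b_le h_le kappa01 E_preimage ball_r.
pose eps := b ^+ 2 +i* h; have b2 := b2_small r_gt0 r_small b_gt0 b_le.
have b3 := b3_small r_gt0 r_small b_gt0 b_le.
have gr : gate_orbit r b h E kappa r%:C.
  split; first by rewrite /= lexx andbT; clear - r_gt0; lra.
    rewrite /= normr0 /drift subrr mulr0 add0r subrr mulr0 mul0r//.
  move=> y yr; apply: ball_r; rewrite (le_trans yr)//.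
  have -> : shrink r (Re r%:C) = 1 by rewrite /shrink /= subrr mulr0 subr0.
  rewrite mulr1.
  case/andP: kappa01 => k0 _; rewrite ler_piMr//.
  rewrite (le_trans (normc_le_ReIm _))// /velocity ReD ImD Re_sqr Im_sqr /=.
  rewrite expr0n /= subr0 mulr0 add0r ger0_norm ?addr_ge0 ?sqr_ge0//.
  have : 10 ^+ 9 * r ^+ 2 <= r.
    by apply: sqr_small => //; rewrite gtr0_norm//; clear - r_gt0; lra.
  by clear - b2 b3 h_le r_small r_gt0; lra.
have b2p : 0 < b ^+ 2 / 2 by rewrite divr_gt0 ?exprn_gt0.
have [y gy yr] : exists2 y, gate_orbit r b h E kappa y & Re y <= - r.
  pose n := (Num.truncn (4 * r / (b ^+ 2 / 2))).+1.
  have nb : 4 * r < n%:R * (b ^+ 2 / 2).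
    by rewrite -ltr_pdivrMr//; exact: truncnS_gt.
  case: (gate_orbit_iter n r_gt0 r_small b_gt0 b_le h_le kappa01 E_preimage gr) => //.
  by move=> -[y [/andP[lo _] _ _] /=]; clear - nb lo r_gt0; lra.
exists y; case: (gy) => /andP[lo hi] Hh Hball.
have X2r : `|Re y| <= 2 * r by rewrite ler_norml; clear - lo hi r_gt0; lra.
have V0 : 0 < Re y ^+ 2 + b ^+ 2 by rewrite ltr_wpDl ?sqr_ge0// exprn_gt0.
have Y240 : `|Im y| <= 240 * (Re y ^+ 2 + b ^+ 2).
  by rewrite (le_trans Hh)// ler_wpM2r ?(ltW V0)// (drift_le r_gt0 r_small b_gt0 lo).
have X2 := sqr_small r_gt0 r_small X2r.
split; first by rewrite lo yr.
  by clear - Y240 X2 b2 r_gt0; lra.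
move=> z zy; apply: Hball; rewrite (le_trans zy)//.
case/andP: kappa01 => k0 _; rewrite -!mulrA ler_wpM2l//.
have sh : 1 / 2 <= shrink r (Re y) by rewrite /shrink; clear - lo r_small; lra.
have vr : r ^+ 2 / 2 <= normc (velocity eps y).
  rewrite (le_trans _ (Re_le_normc _))// (le_trans _ (ler_norm _))//.
  rewrite /velocity ReD Re_sqr /=.
  have rX : r ^+ 2 <= Re y ^+ 2.
    by rewrite -(sqrrN (Re y)) ler_sqr ?nnegrE ?(ltW r_gt0)//; clear - yr r_gt0; lra.
  have : Im y ^+ 2 <= 1 / 2 * (Re y ^+ 2 + b ^+ 2).
    have := ler_pM (normr_ge0 _) (normr_ge0 _) Y240 Y240.
    rewrite -expr2 real_normK ?num_real//.
    have V1 : Re y ^+ 2 + b ^+ 2 <= 1 / 10 ^+ 10.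
      by clear - X2 b2 r_small r_gt0; lra.
    have := mulrB_ge0 (ltW V0) V1; move: (Re y ^+ 2 + b ^+ 2) V0.
    by clear; intros; lra.
  by have := sqr_ge0 b; clear - rX; lra.
have v0 := normc_ge0 (velocity eps y).
have := mulrB_ge0 v0 sh; clear - vr; lra.
Qed.

End Gate.

(** * A disc lost near the parameter 1 *)

Section Dynamics.
Variable R : realType.
Implicit Types (z w lambda : R[i]).

Lemma filled_julia_iter_le3 lambda z n : normc lambda = 1 ->
  filled_julia lambda z -> normc (iter n (quad lambda) z) <= 3.
Proof.
move=> l1 Kz; apply: (filled_julia_le3 l1).
by elim: n => //= n; exact: filled_julia_quad.
Qed.

(** Both orbits stay in the disc of radius 4 as long as they are close, and
    there the bound on their distance grows 11-fold in one step: 8 bounds the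
    factor |1 + a + b| of a - b, and 3 the factor |a| of the change of
    parameter. *)
Lemma shadow lambda z w n : normc lambda = 1 -> filled_julia lambda z ->
  (normc (lambda - 1) + normc (z - w)) * 11 ^+ n <= 1 ->
  forall j, (j <= n)%N -> normc (iter j (quad 1) w) <= 4.
Proof.
move=> l1 Kz small.
have N2 := filled_julia_iter_le3 _ l1 Kz.
set eta := (X in X * _ <= 1) in small.
have eta0 : 0 <= eta by rewrite addr_ge0 ?normc_ge0.
have close j : (j <= n)%N ->
    normc (iter j (quad lambda) z - iter j (quad 1) w) <= eta * 11 ^+ j ->
    normc (iter j (quad 1) w) <= 4.
  move=> jn; set a := iter j _ z; set b := iter j _ w => ab.
  have : eta * 11 ^+ j <= eta * 11 ^+ n by rewrite ler_wpM2l// ler_weXn2l// ler1n.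
  have := normcB_le b a; rewrite -(normcN (b - a)) opprB.
  have := N2 j; rewrite -/a; clear - ab small; lra.
have dist j : (j <= n)%N ->
    normc (iter j (quad lambda) z - iter j (quad 1) w) <= eta * 11 ^+ j.
  elim: j => [_|j IH jn]; first by rewrite expr0 mulr1 lerDr normc_ge0.
  have {}IH := IH (ltnW jn); have b4 := close j (ltnW jn) IH.
  move: b4 IH; rewrite !iterS; have := N2 j.
  set a := iter j _ z; set b := iter j _ w => a3 b4 IH.
  have -> : quad lambda a - quad 1 b = (lambda - 1) * a + (a - b) * (1 + a + b).
    by rewrite /quad; ring.
  have h1 : normc (1 + a + b) <= 8.
    have := le_normcD (1 + a) b; have := le_normcD 1 a; rewrite normc1.
    by clear - a3 b4; lra.
  have h2 : normc ((lambda - 1) * a) <= eta * 3.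
    by rewrite normcM ler_pM ?normc_ge0// lerDl normc_ge0.
  have h3 : normc ((a - b) * (1 + a + b)) <= eta * 11 ^+ j * 8.
    by rewrite normcM ler_pM ?normc_ge0.
  have e1 : 1 <= 11 ^+ j :> R by rewrite exprn_ege1// ler1n.
  have := le_normcD ((lambda - 1) * a) ((a - b) * (1 + a + b)).
  have := mulrB_ge0 eta0 e1; rewrite exprSr.
  by move: (11 ^+ j) h3; clear - h2; intros; lra.
by move=> j jn; exact: close (dist j jn).
Qed.

(** The orbit stays on the positive axis and each step adds at least r^2. *)
Lemma positive_escapes (r : R) : 0 < r ->
  exists n, 4 < normc (iter n (quad 1) r%:C).
Proof.
move=> r0.
have grow n : exists2 a, iter n (quad 1) r%:C = a%:C & r + n%:R * r ^+ 2 <= a.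
  elim: n => [|n [a aE ra]]; first by exists r => //; rewrite mul0r addr0.
  exists (a + a ^+ 2); first by rewrite iterS aE /quad mul1r rmorphD rmorphXn.
  have n0 : 0 <= n%:R * r ^+ 2 by rewrite mulr_ge0 ?sqr_ge0.
  have : r ^+ 2 <= a ^+ 2 by rewrite ler_sqr ?nnegrE; clear - r0 n0 ra; lra.
  by rewrite -natr1; move: n%:R n0 ra; clear; intros; lra.
pose n := (Num.truncn (4 / r ^+ 2)).+1; exists n.
have [a -> ra] := grow n.
have : 4 < n%:R * r ^+ 2.
  by rewrite -ltr_pdivrMr ?exprn_gt0//; exact: truncnS_gt.
have := Re_le_normc a%:C; have := ler_norm a.
by rewrite [Re _]/=; clear - r0 ra; lra.
Qed.

(** Centred at -1/2, the map z + z^2 reads u |-> u^2 + 1/4. *)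
Lemma petal_in_julia z : normc (z + (1 / 2)%:C) <= 1 / 2 -> filled_julia 1 z.
Proof.
move=> z12; apply/filled_juliaP; exists 1.
have half : (1 / 2)%:C = 1 / 2 :> R[i].
  by rewrite rmorphM rmorph1 fmorphV rmorph_nat.
have nhalf (a : R) : 0 <= a -> normc a%:C = a.
  by move=> a0; rewrite /= expr0n addr0 sqrtr_sqr ger0_norm.
have inv n : normc (iter n (quad 1) z + (1 / 2)%:C) <= 1 / 2.
  elim: n => // n; rewrite iterS; set a := iter n _ z => an.
  have -> : quad 1 a + (1 / 2)%:C = (a + (1 / 2)%:C) ^+ 2 + (1 / 4)%:C.
    have -> : (1 / 4)%:C = 1 / 4 :> R[i].
      by rewrite rmorphM rmorph1 fmorphV rmorph_nat.
    by rewrite half /quad; field.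
  rewrite (le_trans (le_normcD _ _))// normcX nhalf ?divr_ge0//.
  have := mulrB_ge0 (normc_ge0 (a + (1 / 2)%:C)) an.
  by clear - an; lra.
move=> n; have := normcB_le (iter n (quad 1) z) (- (1 / 2)%:C).
rewrite opprK normcN nhalf ?divr_ge0//; have := inv n; clear; lra.
Qed.

(** With lambda = c + i s and q = 1 - c, the identity c^2 + s^2 = 1 gives
    eps = q c / 2 + i q s / 2 and s^2 = q (1 + c), so b^2 = q c / 2 is of order
    q and h of order q^(3/2). *)
Lemma gate_parameter lambda (r : R) : normc lambda = 1 -> lambda != 1 ->
  0 < r <= 1 / 2 -> normc (lambda - 1) <= r ->
  exists b h : R, [/\ 0 < b, b <= r, `|h| <= 6 * b ^+ 3 &
    - (1 - lambda) ^+ 2 / 4 = b ^+ 2 +i* h].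
Proof.
case: lambda => c s l1 lN1 /andP[r0 r12] lr.
have cs : c ^+ 2 + s ^+ 2 = 1 by rewrite -[RHS](expr1n _ 2) -l1 normc_sqr.
have l2 : 2 * (1 - c) <= r ^+ 2.
  move: lr; rewrite normc_le_sqr ?(ltW r0)//= oppr0 addr0; clear - cs; lra.
have c1 : c < 1.
  rewrite lt_neqAle; apply/andP; split.
    apply: contra lN1 => /eqP cE; rewrite eq_complex /= cE eqxx /=.
    by rewrite -sqrf_eq0; apply/eqP; move: cs; rewrite cE; clear; lra.
  have : c ^+ 2 <= 1 by have := sqr_ge0 s; clear - cs; lra.
  move=> c21; rewrite leNgt; apply/negP => c1; have := sqr_ge0 (c - 1).
  by clear - c21 c1; lra.
have r2 := mulrB_ge0 (ltW r0) r12.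
have c34 : 3 / 4 <= c by clear - l2 r2 r12; lra.
pose b := Num.sqrt (c * (1 - c) / 2); pose h := (1 - c) * s / 2.
have q0 : 0 < 1 - c by rewrite subr_gt0.
have b2 : b ^+ 2 = c * (1 - c) / 2.
  by rewrite sqr_sqrtr// divr_ge0// mulr_ge0// ?ltW//; clear - c34; lra.
have b0 : 0 < b.
  by rewrite sqrtr_gt0 divr_gt0// mulr_gt0//; clear - c34; lra.
exists b, h; split => //.
- rewrite -ler_sqr ?nnegrE ?(ltW r0) ?(ltW b0)// b2.
  have := mulr_ge0 (ltW q0) (ltW q0); clear - l2 q0; lra.
- have b30 : 0 <= 6 * b ^+ 3 by rewrite mulr_ge0// exprn_ge0// ltW.
  rewrite -ler_sqr ?nnegrE// real_normK ?num_real//.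
  have -> : (6 * b ^+ 3) ^+ 2 = 36 * (b ^+ 2) ^+ 3 by ring.
  rewrite b2 /h.
  have -> : ((1 - c) * s / 2) ^+ 2 = (1 - c) ^+ 3 * ((1 + c) / 4).
    have -> : ((1 - c) * s / 2) ^+ 2 = (1 - c) ^+ 2 / 4 * s ^+ 2 by field.
    have -> : s ^+ 2 = 1 - c ^+ 2 by clear - cs; lra.
    by field.
  have -> : 36 * (c * (1 - c) / 2) ^+ 3 = (1 - c) ^+ 3 * (9 / 2 * c ^+ 3).
    by field.
  rewrite ler_wpM2l ?exprn_ge0 ?(ltW q0)//.
  have c3 : (3 / 4) ^+ 3 <= c ^+ 3.
    by apply: lerXn2r; rewrite ?nnegrE//; clear - c34; lra.
  by clear - c3 c1; lra.
- have -> : - (1 - (c +i* s)) ^+ 2 / 4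
      = (- 1 / 4)%:C * (1 - (c +i* s)) ^+ 2.
    by rewrite rmorphM fmorphV rmorph_nat rmorphN1; field.
  apply/eqP; rewrite eq_complex expr2 /= b2 /h; apply/andP; split; apply/eqP.
    have s2 : s ^+ 2 = 1 - c ^+ 2 by clear - cs; lra.
    transitivity (- 1 / 4 * ((1 - c) ^+ 2 - s ^+ 2)); first by field.
    by rewrite s2; field.
  by field.
Qed.

(** The escaping disc around r is lost by K_lambda, and [gate] carries it back
    to the left of the gate, into the invariant disc of z + z^2. *)
Lemma lost_ball : exists rho eta : R, [/\ 0 < rho, 0 < eta &
  forall lambda, normc lambda = 1 -> lambda != 1 -> normc (lambda - 1) <= eta ->
  exists z0, forall y, normc (y - z0) <= rho ->
    filled_julia 1 y /\ ~ filled_julia lambda y].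
Proof.
have [r [r_gt0 r_small]] : exists r : R, 0 < r /\ 10 ^+ 10 * r <= 1.
  exists (1 / 10 ^+ 10); rewrite divr_gt0 ?exprn_gt0//.
  by rewrite mul1r divff// expf_neq0.
(* The disc of radius e around r escapes for every parameter within e of 1. *)
have [n escape] := positive_escapes r_gt0.
pose e : R := 1 / 11 ^+ n.
have [kappa kappaE] : exists kappa, kappa = e / 4 by eexists.
have e_gt0 : 0 < e by rewrite divr_gt0// exprn_gt0.
have e_le1 : e <= 1 by rewrite /e ler_pdivrMr ?exprn_gt0// mul1r exprn_ege1// ler1n.
have kappa_gt0 : 0 < kappa by rewrite kappaE divr_gt0.
have kappa01 : 0 <= kappa <= 1 by rewrite kappaE; clear - e_gt0 e_le1; lra.
have miss lambda y : normc lambda = 1 ->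
    normc (lambda - 1) + normc (y - r%:C) <= e -> ~ filled_julia lambda y.
  move=> l1 le Ky.
  have le1 : (normc (lambda - 1) + normc (y - r%:C)) * 11 ^+ n <= 1.
    by rewrite -ler_pdivlMr ?exprn_gt0.
  have := shadow l1 Ky le1 (leqnn n).
  by rewrite leNgt escape.
(* The radius is the one [gate] provides; eta below kappa keeps the disc
   around r escaping, eta below r / 100 keeps the exit point in the petal. *)
exists (kappa * r ^+ 2 / 4), (Num.min kappa (r / 100)); split.
- by rewrite !mulr_gt0// ?exprn_gt0// ?invr_gt0.
- by rewrite lt_min kappa_gt0 divr_gt0.
move=> lambda l1 lN1; rewrite le_min => /andP[lk lr].
have r12 : 0 < r <= 1 / 2 by rewrite r_gt0; clear - r_small; lra.
have lr' : normc (lambda - 1) <= r by clear - lr r_gt0; lra.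
have [b [h [b_gt0 b_le h_le epsE]]] := gate_parameter l1 lN1 r12 lr'.
pose mu := (1 - lambda) / 2.
have muE : normc mu <= normc (lambda - 1).
  have -> : lambda - 1 = - (2 * mu) by rewrite /mu; field.
  rewrite normcN (normcM 2 mu) ler_peMl ?normc_ge0//.
  have -> : (2 : R[i]) = 2%:C by rewrite rmorph_nat.
  by rewrite (le_trans _ (Re_le_normc _))//= ger0_norm// ler1n.
pose E : set R[i] := [set y | ~ filled_julia lambda (y + mu)].
have E_pre y : E (y + velocity (b ^+ 2 +i* h) y) -> E y.
  rewrite -epsE /E /= => Ey Ky; apply: Ey.
  have -> : y + velocity (- (1 - lambda) ^+ 2 / 4) y + mu = quad lambda (y + mu).
    by rewrite /velocity /quad /mu; field.
  exact: filled_julia_quad.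
have E_r y : normc (y - r%:C) <= kappa -> E y.
  move=> yr; apply: miss => //.
  have -> : y + mu - r%:C = (y - r%:C) + mu by ring.
  have := le_normcD (y - r%:C) mu.
  by rewrite kappaE in lk yr; clear - yr lk muE e_gt0; lra.
have [x [/andP[x1 x2] x3 Ex]] :=
  gate r_gt0 r_small b_gt0 b_le h_le kappa01 E_pre E_r.
exists (x + mu) => y yx; split; last first.
  have : E (y - mu) by apply: Ex; rewrite -addrA -opprD (addrC mu).
  by rewrite /E /= subrK.
apply: petal_in_julia; rewrite normc_le_sqr ?divr_ge0//.
pose d := y - (x + mu) + mu.
have d_le : normc d <= r / 10.
  rewrite (le_trans (le_normcD _ _))//.
  have : kappa * r ^+ 2 / 4 <= r / 100.
    have k1 : kappa <= 1 by case/andP: kappa01.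
    have := mulrB_ge0 (sqr_ge0 r) k1.
    have := mulrB_ge0 (ltW r_gt0) r_small.
    by clear - r_gt0; lra.
  by clear - yx muE lr r_gt0; lra.
have dR := le_trans (Re_le_normc d) d_le.
have dI := le_trans (Im_le_normc d) d_le.
have -> : y + (1 / 2)%:C = x + d + (1 / 2)%:C by rewrite /d; ring.
have [reH imH] : Re (1 / 2)%:C = 1 / 2 :> R /\ Im (1 / 2)%:C = 0 :> R by [].
rewrite (ReD (x + d)) (ImD (x + d)) (ReD x) (ImD x) reH imH addr0.
move: dR dI x3; rewrite !ler_norml => /andP[p1 p2] /andP[q1 q2] /andP[m1 m2].
move: x1 x2 m1 m2 p1 p2 q1 q2; move: (Re x) (Im x) (Re d) (Im d) => X Y D I.
clear - r_gt0 r_small => *.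
have P : (X + D) ^+ 2 <= 9 * r ^+ 2.
  have h1 : - (3 * r) <= X + D by lra.
  have h2 : X + D <= 0 by lra.
  have h3 : 0 <= - (X + D) by lra.
  have := mulrB_ge0 h3 h1; have := mulrB_ge0 (ltW r_gt0) h1; lra.
have Q : (Y + I) ^+ 2 <= r ^+ 2.
  have h1 : Y + I <= r by lra.
  have h2 : - r <= Y + I by lra.
  have := mulr_ge0 (_ : 0 <= r - (Y + I)) (_ : 0 <= r + (Y + I)).
  by rewrite subr_ge0 -lerBlDl sub0r => /(_ h1 h2); clear; lra.
have := mulrB_ge0 (ltW r_gt0) r_small.
have : X + D <= - (r / 2) by lra.
by clear - P Q r_gt0; lra.
Qed.

End Dynamics.

(** * Areas *)

Section Area.
Variable R : realType.
Implicit Types (lambda : R[i]) (A B : set R[i]).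

Definition plane A : set (R * R) := [set p | A (p.1 +i* p.2)].

Lemma Re_quad lambda z : Re (quad lambda z) =
  (Re lambda * Re z - Im lambda * Im z) + (Re z * Re z - Im z * Im z).
Proof. by case: lambda z => [a b] [c d]; rewrite /quad expr2. Qed.

Lemma Im_quad lambda z : Im (quad lambda z) =
  (Re lambda * Im z + Im lambda * Re z) + (Re z * Im z + Im z * Re z).
Proof. by case: lambda z => [a b] [c d]; rewrite /quad expr2. Qed.

Lemma measurable_iter lambda n :
  measurable_fun setT (fun p : R * R => Re (iter n (quad lambda) (p.1 +i* p.2))) /\
  measurable_fun setT (fun p : R * R => Im (iter n (quad lambda) (p.1 +i* p.2))).
Proof.
elim: n => [|n [mRe mIm]]; first by split; [exact: measurable_fst|exact: measurable_snd].
split.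
- apply: (@eq_measurable_fun _ _ _ _ _ (fun p : R * R =>
    let z := iter n (quad lambda) (p.1 +i* p.2) in
    (Re lambda * Re z - Im lambda * Im z) + (Re z * Re z - Im z * Im z))).
    by move=> p _; rewrite iterS Re_quad.
  by apply: measurable_funD; apply: measurable_funB; apply: measurable_funM.
- apply: (@eq_measurable_fun _ _ _ _ _ (fun p : R * R =>
    let z := iter n (quad lambda) (p.1 +i* p.2) in
    (Re lambda * Im z + Im lambda * Re z) + (Re z * Im z + Im z * Re z))).
    by move=> p _; rewrite iterS Im_quad.
  by apply: measurable_funD; apply: measurable_funD; apply: measurable_funM.
Qed.

Lemma measurable_level lambda n (B : R) : 0 <= B ->
  measurable (plane [set z | normc (iter n (quad lambda) z) <= B]).
Proof.
move=> B0; have [mRe mIm] := measurable_iter lambda n.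
have -> : plane [set z | normc (iter n (quad lambda) z) <= B] =
    setT `&` (fun p : R * R =>
      Re (iter n (quad lambda) (p.1 +i* p.2)) ^+ 2 +
      Im (iter n (quad lambda) (p.1 +i* p.2)) ^+ 2) @^-1` `]-oo, B ^+ 2].
  apply/seteqP; split => p.
    by rewrite /plane /mkset normc_le_sqr// => Hp; split; rewrite //= in_itv.
  by case=> _; rewrite /= in_itv /= -normc_le_sqr.
apply: measurable_funD; rewrite ?measurableT//; exact: measurable_funX.
Qed.

Lemma filled_julia_le (B : R) lambda : 3 <= B -> normc lambda = 1 ->
  filled_julia lambda = \bigcap_n [set z | normc (iter n (quad lambda) z) <= B].
Proof.
move=> B3 l1; apply/seteqP; split => z.
  by move=> Kz n _ /=; rewrite (le_trans _ B3)// filled_julia_iter_le3.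
by move=> Kz; apply/filled_juliaP; exists B => n; exact: Kz.
Qed.

Lemma measurable_filled_julia lambda : normc lambda = 1 ->
  measurable (plane (filled_julia lambda)).
Proof.
move=> l1; rewrite (filled_julia_le (lexx _) l1).
have -> : plane (\bigcap_n [set z | normc (iter n (quad lambda) z) <= 3]) =
   \bigcap_n (plane [set z | normc (iter n (quad lambda) z) <= 3]) by [].
by apply: bigcap_measurable => [|n _]; [exists 0%N|exact: measurable_level].
Qed.

Definition rect (a b s : R) : set (R * R) :=
  `[a - s, a + s] `*` `[b - s, b + s].

Lemma area_rect (a b s : R) : 0 < s ->
  (@lebesgue_measure R \x @lebesgue_measure R)%E (rect a b s) =
  ((2 * s) ^+ 2)%:E.
Proof.
move=> s0; rewrite product_measure1E//.
rewrite /= !lebesgue_measure_itv /= !lte_fin !ltrD2l !gtrN//.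
rewrite -!EFinD -EFinM; congr EFin; ring.
Qed.

Lemma measurable_rect a b s : measurable (rect a b s).
Proof. exact: measurableX. Qed.

Lemma normc_rect a b s (z : R[i]) : rect a b s (Re z, Im z) ->
  normc (z - (a +i* b)) <= 2 * s.
Proof.
case: z => x y [hx hy]; rewrite (le_trans (normc_le_ReIm _))//.
move: hx hy; rewrite /= !in_itv /= => /andP[x1 x2] /andP[y1 y2].
by rewrite mulr_natl mulr2n lerD// ler_norml; clear - x1 x2 y1 y2; lra.
Qed.

Local Notation leb2 := (@lebesgue_measure R \x @lebesgue_measure R)%E.

(** The bound is 4, while bounded orbits have modulus at most 3: this leaves the
    room for these sets to contain the filled Julia sets of nearby
    parameters. *)
Definition stays n : set (R * R) :=
  plane [set z | forall j, (j <= n)%N -> normc (iter j (quad 1) z) <= 4].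

Lemma measurable_stays n : measurable (stays n).
Proof.
have -> : stays n = \bigcap_(j in [set j | (j <= n)%N])
    plane [set z | normc (iter j (quad 1) z) <= 4] by [].
by apply: bigcap_measurable => [|j _]; [exists 0%N|exact: measurable_level].
Qed.

Lemma bigcap_stays : \bigcap_n stays n = plane (filled_julia 1).
Proof.
apply/seteqP; split => p; last first.
  move=> Kp n _ j _; rewrite (le_trans (filled_julia_iter_le3 _ _ Kp)) ?normc1//.
  by rewrite ler_nat.
by move=> Sp; apply/filled_juliaP; exists 4 => n; exact: (Sp n I n (leqnn n)).
Qed.

Lemma stays_fin : (leb2 (stays 0) < +oo)%E.
Proof.
apply: (@le_lt_trans _ _ (leb2 (rect 0 0 4))); last by rewrite area_rect// ltry.
apply: le_measure; rewrite ?inE; [exact: measurable_stays|exact: measurable_rect|].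
move=> p /(_ 0%N isT) p4; split; rewrite /= in_itv /= !add0r -ler_norml.
  exact: le_trans (Re_le_normc (p.1 +i* p.2)) p4.
exact: le_trans (Im_le_normc (p.1 +i* p.2)) p4.
Qed.

Lemma area_julia_fin : leb2 (plane (filled_julia 1)) \is a fin_num.
Proof.
rewrite ge0_fin_numE// (le_lt_trans _ stays_fin)//.
apply: le_measure; rewrite ?inE; [|exact: measurable_stays|].
  by apply: measurable_filled_julia; rewrite normc1.
by rewrite -bigcap_stays => p; exact.
Qed.

Lemma area_stays (e : R) : 0 < e ->
  exists n, (leb2 (stays n) < leb2 (plane (filled_julia 1%R)) + e%:E)%E.
Proof.
move=> e0.
have nondec : nonincreasing_seq stays.
  by move=> m n mn; apply/subsetPset => p Sp j jm; apply: Sp; exact: leq_trans mn.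
have cvg1 : leb2 \o stays @ \oo --> leb2 (\bigcap_n stays n).
  apply: nonincreasing_cvg_mu => //; first exact: stays_fin.
    exact: measurable_stays.
  by rewrite bigcap_stays; apply: measurable_filled_julia; rewrite normc1.
have cvg2 : leb2 \o stays @ \oo --> ereal_inf (range (leb2 \o stays)).
  apply: ereal_nonincreasing_cvgn => m n mn.
  apply: le_measure; rewrite ?inE; [exact: measurable_stays..|].
  exact/subsetPset/nondec.
have infE : ereal_inf (range (leb2 \o stays)) = leb2 (plane (filled_julia 1)).
  by rewrite -bigcap_stays; exact: cvg_unique cvg2 cvg1.
have [|_ [n _ <-] ltn] := @lb_ereal_inf_adherent R (range (leb2 \o stays)) e e0.
  by rewrite infE area_julia_fin.
by exists n; rewrite -infE.
Qed.

(** For n large, [stays n] exceeds the filled Julia set at 1 by less than half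
    the area of the square S inscribed in the lost disc, and it contains the
    filled Julia set at lambda and S, which are disjoint. *)
Lemma area_drop : exists eta delta : R, [/\ 0 < eta, 0 < delta &
  forall lambda, normc lambda = 1 -> lambda != 1 -> normc (lambda - 1) <= eta ->
  (area (filled_julia lambda) <= area (filled_julia (1%R : R[i])) - delta%:E)%E].
Proof.
have [rho [eta [rho0 eta0 lost]]] := lost_ball R.
pose s := rho / 2; have s0 : 0 < s by rewrite divr_gt0.
pose delta := (2 * s) ^+ 2 / 2.
have delta0 : 0 < delta by rewrite divr_gt0 ?exprn_gt0 ?mulr_gt0.
have [n small] := area_stays delta0.
have n0 : 0 < 11 ^+ n :> R by rewrite exprn_gt0.
exists (Num.min eta (1 / 11 ^+ n)), delta; split => //.
  by rewrite lt_min eta0 divr_gt0.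
move=> lambda l1 lN1; rewrite le_min => /andP[leta ln].
have [z0 Hz0] := lost lambda l1 lN1 leta.
pose S := rect (Re z0) (Im z0) s.
have mK := measurable_filled_julia l1.
have mS : measurable S by exact: measurable_rect.
have SK p : S p -> filled_julia 1 (p.1 +i* p.2) /\ ~ filled_julia lambda (p.1 +i* p.2).
  move=> Sp; apply: Hz0.
  have -> : rho = 2 * s by rewrite /s; field.
  have z0E : z0 = Re z0 +i* Im z0 by clear; case: z0.
  rewrite [X in _ - X]z0E.
  by apply: normc_rect; case: p Sp.
have sub : plane (filled_julia lambda) `|` S `<=` stays n.
  move=> p [Kp|/SK[Kp _]] j jn.
    apply: (shadow l1 Kp _ jn).
    by rewrite subrr normc0 addr0 -ler_pdivlMr.
  rewrite (le_trans (filled_julia_iter_le3 _ _ Kp)) ?normc1//.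
  by rewrite ler_nat.
have disj : plane (filled_julia lambda) `&` S = set0.
  by apply/seteqP; split => // p [Kp /SK[]].
have sumle : (leb2 (plane (filled_julia lambda)) + ((2 * s) ^+ 2)%:E <= leb2 (stays n))%E.
  rewrite -(@area_rect (Re z0) (Im z0) s s0) -measureU//.
  by apply: le_measure; rewrite ?inE//; [exact: measurableU|exact: measurable_stays].
have := le_lt_trans sumle small.
rewrite /area -/(plane (filled_julia lambda)) -/(plane (filled_julia 1)).
have := area_julia_fin; case: (leb2 (plane (filled_julia 1))) => [k| |] // _.
have : (0 <= leb2 (plane (filled_julia lambda)))%E by [].
case: (leb2 (plane (filled_julia lambda))) => [l| |] // _.
rewrite -!EFinD lte_fin lee_fin /delta => H.
by move: ((2 * s) ^+ 2) H => u; clear; lra.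
Qed.

End Area.

Theorem theorem1p1 (R : realType) :
  (limf_esup (fun lambda : R[i]^o => area (filled_julia lambda))
     (within (@unit_circle R) (1%R : R[i]^o)^')
   < area (filled_julia (1%R : R[i])))%E.
Proof.
have [eta [delta [eta0 delta0 drop]]] := area_drop R.
have fin := area_julia_fin R.
apply: (@le_lt_trans _ _ (area (filled_julia (1%R : R[i])) - delta%:E)%E); last first.
  by rewrite lteBlDr// lteDl// lte_fin.
pose A : set R[i]^o := [set lambda | [/\ normc lambda = 1, lambda != 1 &
   normc (lambda - 1) <= eta]].
apply: (@le_trans _ _ (ereal_sup ((fun lambda : R[i]^o => area (filled_julia lambda)) @` A))).
  apply: ereal_inf_lbound; exists A => //.
  rewrite /within /= /dnbhs /within /=; apply/nbhs_ballP; exists eta%:C => /=.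
    by rewrite ltcR.
  move=> lambda; rewrite -ball_normE /= => lball lN1 l1; split => //.
    by move: l1; rewrite /unit_circle /= (normC_normc lambda) => -[].
  move: lball; rewrite -normrN opprB (normC_normc (lambda - 1)) ltcR; exact: ltW.
apply: ge_ereal_sup => _ [lambda [l1 lN1 leta] <-]; exact: drop.
Qed.
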